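(* Let $(X,\mu)$ and $(Y,\nu)$ be nonatomic Polish measure spaces (so that $X$ and $Y$ are uncountable). Then the generic measure space map from $(X,\mu)$ to $(Y,\nu)$ is invertible: in the space of measure space maps $T:(X,\mu)\to(Y,\nu)$ (maps equal a.e. being identified), the set of measure space isomorphisms is residual, i.e. contains a dense $G_\delta$ subset.
   Context: A Polish measure space $(X,\mu)$ is a Polish (separable, completely metrizable) space $X$ with its Borel $\sigma$-algebra $\mathcal{B}_X$ and a finite or $\sigma$-finite measure $\mu$ with $\mu(X)>0$. It is nonatomic if there is no measurable $A$ with $\mu(A)>0$ all of whose measurable subsets have measure $0$ or $\mu(A)$. A measure space map $T:(X,\mu)\to(Y,\nu)$ is a measurable map with $\mu(T^{-1}(B))=\nu(B)$ for all $B\in\mathcal{B}_Y$. It is a measure space isomorphism when there is a measure space map $\hat T:(Y,\nu)\to(X,\mu)$ with $\hat T\circ T=id_X$ a.e. and $T\circ\hat T=id_Y$ a.e. The measure algebra $\mathcal{M}_X$ is the set of classes (modulo null sets) of measurable sets of finite measure with metric $d(A,B)=\mu(A+B)$, where $A+B=(A\cup B)\setminus(A\cap B)$. Each measure space map $T$ induces $T^*:\mathcal{M}_Y\to\mathcal{M}_X$, $B\mapsto T^{-1}(B)$. The topology on the space of measure space maps is that of pointwise convergence of the maps $T^*$ on $\mathcal{M}_Y$: $T_i\to T$ when $\mu(T_i^{-1}(E)+T^{-1}(E))\to 0$ for every $E\in\mathcal{M}_Y$. This space is completely metrizable. *)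

(* Defs.v *)
From HB Require Import structures.
From mathcomp Require Import all_boot all_order all_algebra.
From mathcomp Require Import all_classical all_reals all_analysis borel_hierarchy.
Set Implicit Arguments.
Unset Strict Implicit.
Unset Printing Implicit Defensive.
Import Order.TTheory GRing.Theory Num.Theory.
Import numFieldNormedType.Exports.
Local Open Scope classical_set_scope.
Local Open Scope ring_scope.
Local Open Scope quotient_scope.

Definition separable (T : topologicalType) :=
  exists2 D : set T, countable D & dense D.

Definition completely_metrizable (R : realType) (T : topologicalType) :=
  exists d : T -> T -> R,
    [/\ forall x y, d x y = 0 <-> x = y,
        forall x y, d x y = d y x,
        forall x y z, d x z <= d x y + d y z,
        forall x : T, nbhs x =
          filter_from [set e : R | 0 < e] (fun e => [set y | d x y < e])
      & forall u : nat -> T,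
          (forall e : R, 0 < e -> exists N, forall m n,
             (N <= m)%N -> (N <= n)%N -> d (u m) (u n) < e) ->
          exists l : T, u n @[n --> \oo] --> l].

Definition polish (R : realType) (T : topologicalType) :=
  separable T /\ completely_metrizable R T.

Notation borel X := (g_sigma_algebraType (@open X)).

Section measure.
Context d (T : measurableType d) (R : realType).
Variable mu : {measure set T -> \bar R}.
Local Open Scope ereal_scope.

Definition nonatomic :=
  ~ exists A : set T, [/\ measurable A, 0 < mu A &
      forall B, measurable B -> B `<=` A -> mu B = 0 \/ mu B = mu A].

Definition fin_meas : set (set T) := [set A | measurable A /\ mu A < +oo].

Lemma measurableY (A B : set T) :
  measurable A -> measurable B -> measurable (A `+` B).
Proof.
by move=> mA mB; rewrite setY_def; apply: measurableU; exact: measurableD.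
Qed.

Lemma measureY_triangle (A B C : set T) :
  measurable A -> measurable B -> measurable C ->
  mu (A `+` C) <= mu (A `+` B) + mu (B `+` C).
Proof.
move=> mA mB mC.
apply: le_trans (measureU2 mu (measurableY mA mB) (measurableY mB mC)).
apply: le_measure; rewrite ?inE; try exact: measurableY.
  by apply: measurableU; exact: measurableY.
rewrite !setY_def => x [[Ax nCx]|[Cx nAx]].
- by have [Bx|nBx] := pselect (B x); [right; left|left; left].
- by have [Bx|nBx] := pselect (B x); [left; right|right; right].
Qed.

Lemma fin_measY (A B : fin_meas) : mu (val A `+` val B) \is a fin_num.
Proof.
have [mA fA] := set_valP A; have [mB fB] := set_valP B.
rewrite ge0_fin_numE//; apply: le_lt_trans (lte_add_pinfty fA fB).
apply: le_trans (measureU2 mu mA mB).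
apply: le_measure; rewrite ?inE; [exact: measurableY|exact: measurableU|].
by rewrite setY_def => x [[Ax _]|[Bx _]]; [left|right].
Qed.

Definition meas_dist (A B : fin_meas) : R := fine (mu (val A `+` val B)).

Lemma meas_dist_sym A B : meas_dist A B = meas_dist B A.
Proof. by rewrite /meas_dist setYC. Qed.

Lemma meas_distxx A : meas_dist A A = 0%R.
Proof. by rewrite /meas_dist setYK measure0. Qed.

Lemma meas_dist_ge0 A B : (0 <= meas_dist A B)%R.
Proof. by rewrite /meas_dist fine_ge0. Qed.

Lemma meas_dist_triangle B A C :
  (meas_dist A C <= meas_dist A B + meas_dist B C)%R.
Proof.
rewrite /meas_dist -fineD ?fin_measY// fine_le ?fin_numD ?fin_measY//.
have [[mA _] [mB _] [mC _]] := And3 (set_valP A) (set_valP B) (set_valP C).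
exact: measureY_triangle.
Qed.

Definition meas_eq (A B : fin_meas) : bool := meas_dist A B == 0%R.

Let meas_eq_refl : reflexive meas_eq.
Proof. by move=> A; rewrite /meas_eq meas_distxx. Qed.

Let meas_eq_sym : symmetric meas_eq.
Proof. by move=> A B; rewrite /meas_eq meas_dist_sym. Qed.

Let meas_eq_trans : transitive meas_eq.
Proof.
move=> B A C /eqP AB /eqP BC; rewrite /meas_eq eq_le meas_dist_ge0 andbT.
by rewrite (le_trans (meas_dist_triangle B A C))// AB BC addr0.
Qed.

Canonical meas_eq_equiv := EquivRel meas_eq meas_eq_refl meas_eq_sym meas_eq_trans.

Definition measure_algebra : Type := {eq_quot meas_eq}.
HB.instance Definition _ := Choice.on measure_algebra.
HB.instance Definition _ := EqQuotient.on measure_algebra.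

Definition malg_dist (A B : measure_algebra) : R := meas_dist (repr A) (repr B).

Let malg_distxx A : malg_dist A A = 0%R. Proof. exact: meas_distxx. Qed.

Let malg_dist_positivity A B : malg_dist A B = 0%R -> A = B.
Proof.
by move=> /eqP AB; rewrite -(reprK A) -(reprK B); apply/eqmodP.
Qed.

Let malg_dist_sym A B : malg_dist A B = malg_dist B A.
Proof. exact: meas_dist_sym. Qed.

Let malg_dist_triangle B A C :
  (malg_dist A C <= malg_dist A B + malg_dist B C)%R.
Proof. exact: meas_dist_triangle. Qed.

HB.instance Definition _ := @isMetric.Build R measure_algebra malg_dist
  malg_distxx malg_dist_positivity malg_dist_sym malg_dist_triangle.

Lemma malg_dist_pi (A B : fin_meas) :
  malg_dist (\pi_measure_algebra A) (\pi_measure_algebra B) = meas_dist A B.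
Proof.
have rd C : meas_dist (repr (\pi_measure_algebra C)) C = 0%R.
  by apply/eqP; rewrite -[_ == _]/(meas_eq _ _); apply/eqmodP; rewrite reprK.
apply/eqP; rewrite eq_le; apply/andP; split.
- rewrite (le_trans (meas_dist_triangle A _ _))// rd add0r.
  rewrite (le_trans (meas_dist_triangle B _ _))//.
  by rewrite [X in (_ + X)%R]meas_dist_sym rd addr0.
- rewrite (le_trans (meas_dist_triangle (repr (\pi_measure_algebra A)) _ _))//.
  rewrite meas_dist_sym rd add0r.
  rewrite (le_trans (meas_dist_triangle (repr (\pi_measure_algebra B)) _ _))//.
  by rewrite rd addr0.
Qed.

End measure.

Section measure_space_maps.
Context d1 d2 (X : measurableType d1) (Y : measurableType d2) (R : realType).
Variables (mu : {measure set X -> \bar R}) (nu : {measure set Y -> \bar R}).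
Local Open Scope ereal_scope.

Definition measure_preserving (T : X -> Y) :=
  forall B, measurable B -> mu (T @^-1` B) = nu B.

(** An element of [{mfun_ mu, X >-> Y}], a class of measurable functions modulo
    equality [mu]-a.e., acts as a function through a representative; [pi_msmap]
    and [pullback_pi] state that the choice of representative is immaterial. *)
Definition msmap : set {mfun_ mu, X >-> Y} :=
  [set T | measure_preserving T].

Lemma preimage_fin_meas (T : msmap) (B : fin_meas nu) :
  fin_meas mu (val T @^-1` val B).
Proof.
have [mB fB] := set_valP B; split; last by rewrite (set_valP T).
rewrite -[X in measurable X]setTI.
exact: (@measurable_funPT _ _ _ _ (repr (val T))).
Qed.

Definition pullback (T : msmap) :
    {ptws measure_algebra nu -> measure_algebra mu} :=
  fun B => \pi_(measure_algebra mu)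
    (SigSub (mem_set (preimage_fin_meas T (repr B)))).

Definition msmap_space : Type := initial_topology pullback.
HB.instance Definition _ := Topological.on msmap_space.

Lemma ae_eq_preimage (f g : {mfun X >-> Y}) (B : set Y) :
  f = g %[ae mu] -> measurable B -> mu (f @^-1` B `+` g @^-1` B) = 0.
Proof.
move=> fg mB; apply/negligibleP.
  by apply: measurableY; rewrite -[X in measurable X]setTI;
    exact: measurable_funPT.
apply: negligibleS fg; rewrite setY_def => x [[fB ngB]|[gB nfB]] /(_ I) fgx.
- by apply: ngB; rewrite /preimage/= -fgx.
- by apply: nfB; rewrite /preimage/= fgx.
Qed.

Lemma measureY0_eq (A B : set X) : measurable A -> measurable B ->
  mu (A `+` B) = 0 -> mu A = mu B.
Proof.
move=> mA mB AB0; have := measureY_triangle mu mA mB measurable0.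
have := measureY_triangle mu mB mA measurable0.
by rewrite !setY0 (setYC B) AB0 !add0e => BA AB; apply/eqP; rewrite eq_le AB BA.
Qed.

Let repr_pi_ae (f : {mfun X >-> Y}) :
  (repr (\pi_{mfun_ mu, X >-> Y} f) : {mfun X >-> Y}) = f %[ae mu].
Proof.
apply/asboolP; rewrite -[is_true _]/(is_true (ae_eq_op mu _ _)).
by apply/eqmodP; rewrite reprK.
Qed.

Lemma pi_msmap (f : {mfun X >-> Y}) :
  msmap (\pi_{mfun_ mu, X >-> Y} f) <-> measure_preserving f.
Proof.
have e B : measurable B ->
    mu (aqEqMfun_to_fun (\pi_{mfun_ mu, X >-> Y} f) @^-1` B) = mu (f @^-1` B).
  move=> mB; apply: measureY0_eq; last exact: ae_eq_preimage (repr_pi_ae f) mB.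
  - by rewrite -[X in measurable X]setTI; exact: measurable_funPT.
  - by rewrite -[X in measurable X]setTI; exact: measurable_funPT.
by split=> H B mB; have := H B mB; rewrite e.
Qed.

Lemma pullback_pi (T : msmap) (f : {mfun X >-> Y}) (B : fin_meas nu)
    (fB : fin_meas mu (f @^-1` val B)) :
  val T = \pi_{mfun_ mu, X >-> Y} f ->
  pullback T (\pi_(measure_algebra nu) B)
    = \pi_(measure_algebra mu) (SigSub (mem_set fB)).
Proof.
move=> Tf.
have mpre (g : {mfun X >-> Y}) D : measurable D -> measurable (g @^-1` D).
  by move=> mD; rewrite -[X in measurable X]setTI; exact: measurable_funPT.
set C := repr (\pi_(measure_algebra nu) B).
have [mB _] := set_valP B; have [mC _] := set_valP C.
have CB0 : nu (val C `+` val B) = 0.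
  have /eqP : meas_eq C B by apply/eqmodP; rewrite reprK.
  by rewrite /meas_dist => CB; rewrite -[LHS]fineK ?fin_measY// CB.
have fmp : measure_preserving f.
  by apply/pi_msmap; rewrite -Tf; exact: set_valP.
have reprT : (repr (val T) : {mfun X >-> Y}) = f %[ae mu].
  by rewrite Tf; exact: repr_pi_ae.
apply/eqmodP/eqP; rewrite /meas_dist [X in fine X](_ : _ = 0)//=.
apply/eqP; rewrite eq_le measure_ge0 andbT.
apply: le_trans (measureY_triangle mu (mpre _ _ mC) (mpre f _ mC) (mpre f _ mB)) _.
rewrite (ae_eq_preimage reprT mC) add0e.
have -> : f @^-1` val C `+` f @^-1` val B = f @^-1` (val C `+` val B).
  by rewrite !setY_def.
by rewrite fmp ?CB0//; exact: measurableY.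
Qed.

Lemma cvg_pullbackP (F : set_system msmap_space) (T : msmap_space) :
  Filter F ->
  (F --> T) <-> forall E : measure_algebra nu,
    pullback S E @[S --> F] --> pullback T E.
Proof.
move=> FF; split=> H.
- move=> E; apply: (@cvg_trans _ ((fun S : msmap_space => pullback S E) @ (nbhs T))).
    exact: cvg_app H.
  have c1 : continuous (pullback : msmap_space -> {ptws _ -> _}) by exact: initial_continuous.
  have c2 : continuous (fun g : {ptws measure_algebra nu -> measure_algebra mu} => g E).
    by exact: (@proj_continuous _ (fun=> measure_algebra mu) E).
  exact: (continuous_comp (c1 T) (c2 _)).
- move=> A; rewrite nbhsE => -[B [[C oC CB] BT] BA].
  apply: filterS BA _; rewrite -CB.
  have := (@cvg_sup _ _ (fun i => Topological.class (initial_topology (fun f : (forall i : measure_algebra nu, measure_algebra mu) => f i))) (pullback @ F) (pullback T) _).2.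
  move=> h; apply: h; last first.
    by apply: open_nbhs_nbhs; split => //; move: BT; rewrite -CB.
  move=> E D; rewrite nbhsE => -[B' [[C' oC' CB'] BT'] BA'].
  apply: filterS BA' _; rewrite -CB'; apply: (H E).
  by apply: open_nbhs_nbhs; split => //; move: BT'; rewrite -CB'.
Qed.

Lemma cvg_msmap_spaceP (F : set_system msmap_space) (T : msmap_space) :
  Filter F ->
  (F --> T) <-> forall E : fin_meas nu,
    fine (mu (val (S : msmap) @^-1` val E `+` val (T : msmap) @^-1` val E))
      @[S --> F] --> (0 : R)%R.
Proof.
move=> FF.
have key (S U : msmap) (E : fin_meas nu) : malg_dist (pullback S (\pi_(measure_algebra nu) E))
      (pullback U (\pi_(measure_algebra nu) E))
    = fine (mu (val S @^-1` val E `+` val U @^-1` val E)).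
  rewrite (@pullback_pi S (repr (val S)) E (preimage_fin_meas S E)) ?reprK//.
  rewrite (@pullback_pi U (repr (val U)) E (preimage_fin_meas U E)) ?reprK//.
  by rewrite malg_dist_pi.
rewrite cvg_pullbackP; split=> H E.
- apply/cvgrPdist_lt => e e0.
  have h0 := H (\pi_(measure_algebra nu) E).
  have nb := @nbhsx_ballx R _ (pullback T (\pi_(measure_algebra nu) E)) e e0.
  have := h0 _ nb; apply: (@filterS _ F FF) => S.
  rewrite -key sub0r normrN.
  rewrite /= ballEmdist /= => h.
  rewrite ger0_norm; last by exact: meas_dist_ge0.
  by rewrite /malg_dist meas_dist_sym.
- move=> A; rewrite -nbhs_ballE => -[e e0 eA]; apply: (@filterS _ F FF _ _ (fun S => eA (pullback S E))) _.
  move: (H (repr E)) => /cvgrPdist_lt /(_ e e0); apply: (@filterS _ F FF) => S.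
  rewrite -key sub0r normrN reprK ballEmdist /= ger0_norm; last by exact: meas_dist_ge0.
  by rewrite /malg_dist meas_dist_sym.
Qed.

End measure_space_maps.
Arguments measure_preserving {d1 d2 X Y R} mu nu T.
Arguments msmap {d1 d2 X Y R} mu nu.
Arguments msmap_space {d1 d2 X Y R} mu nu.

Definition msmap_isomorphism d1 d2 (X : measurableType d1)
    (Y : measurableType d2) (R : realType) (mu : {measure set X -> \bar R})
    (nu : {measure set Y -> \bar R}) : set (msmap_space mu nu) :=
  [set T : msmap mu nu | exists S : msmap nu mu,
    (val S \o val T = id %[ae mu]) /\ (val T \o val S = id %[ae nu])].

Arguments msmap_isomorphism {d1 d2 X Y R} mu nu.

Definition residual (T : topologicalType) (A : set T) :=
  exists G : set T, [/\ Gdelta G, dense G & G `<=` A].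

(* Main.v *)
Require Import Defs.
From HB Require Import structures.
From mathcomp Require Import all_boot all_order all_algebra.
From mathcomp Require Import all_classical all_reals all_analysis.
From mathcomp Require Import borel_hierarchy measurable_realfun lra zify.
Set Implicit Arguments.
Unset Strict Implicit.
Unset Printing Implicit Defensive.
Import Order.TTheory GRing.Theory Num.Theory.
Import numFieldNormedType.Exports.
Local Open Scope classical_set_scope.
Local Open Scope ring_scope.

(** A map [T] is an isomorphism as soon as every Borel subset of [X] is, up to a
    null set, some [T^-1(E)]: completeness of [X] then yields a left inverse,
    which is automatically a measure preserving two-sided inverse. For a
    countable family of sets [A] of finite measure generating the Borel sets,
    this says that for all [A] and all [e > 0] some [E] has
    [mu(T^-1(E) + A) < e], a countable intersection of open conditions, so the
    isomorphisms form a G_delta set.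

    For density, let [k : Y -> nat] have fibres of finite measure. Choose an
    injective Borel height [h' : Y -> [0, +oo[] in which the fibres of [k] occur
    in increasing order, and [h] on [X] likewise for the fibres of [k o T].
    Composing [h] and [h'] with their (continuous, by nonatomicity) distribution
    functions gives isomorphisms [f] and [f'] of [X] and [Y] with the same
    interval carrying Lebesgue measure, and [S := f'^-1 o f] is an isomorphism
    with [k o S = k o T] a.e. As [k] varies these [S] converge to [T]. *)

(** * Countable set operations and almost-everywhere pullbacks *)

Section countable_index.
Context d (T : measurableType d) (I : countType).
Implicit Types (P : set I) (F : I -> set T).

Lemma bigcup_count_measurable P F :
  (forall i, measurable (F i)) -> measurable (\bigcup_(i in P) F i).
Proof.
move=> mF; rewrite bigcup_mkcond; apply: countable_bigcupT_measurable => // i.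
by case: ifP.
Qed.

Lemma bigcap_count_measurable P F :
  (forall i, measurable (F i)) -> measurable (\bigcap_(i in P) F i).
Proof.
move=> mF; rewrite -[X in measurable X]setCK setC_bigcap.
by apply/measurableC/bigcup_count_measurable => i; exact: measurableC.
Qed.

End countable_index.

Section ae_pullback.
Context d d' (X : measurableType d) (Z : measurableType d') (R : realType).
Variables (mu : {measure set X -> \bar R}) (f : X -> Z).

Definition ae_pullback (A : set X) : Prop :=
  exists2 B, measurable B & \forall x \ae mu, B (f x) <-> A x.

(** Preimages commute with complements and countable unions, and countably many null sets have a
    null union. Hence being a pullback needs checking only on generators. *)
Lemma sigma_algebra_ae_pullback : sigma_algebra setT ae_pullback.
Proof.
split.
- by exists set0 => //; apply: aeW.
- move=> A [B mB BA]; exists (~` B); first exact: measurableC.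
  by apply: filterS BA => x BA; split=> [nB|[_ nA]]; [split=> // /BA|move=> /BA].
- move=> A pA.
  have /choice[B BP] : forall n, exists B,
      measurable B /\ \forall x \ae mu, B (f x) <-> A n x.
    by move=> n; have [B ? ?] := pA n; exists B.
  exists (\bigcup_n B n).
    by apply: bigcupT_measurable => n; have [] := BP n.
  have : \forall x \ae mu, forall n, B n (f x) <-> A n x.
    by apply: ae_foralln => n; have [] := BP n.
  apply: filterS => x BA.
  by split=> -[n _ /BA ?]; exists n.
Qed.

Lemma ae_pullback_sigma (G : set (set X)) :
  G `<=` ae_pullback -> <<s G >> `<=` ae_pullback.
Proof. by apply: smallest_sub; exact: sigma_algebra_ae_pullback. Qed.

End ae_pullback.

(** * Complete metrics with a dense sequence *)

Record dense_metric (R : realType) (X : topologicalType) := DenseMetric {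
  dist : X -> X -> R;
  pt : nat -> X;
  dist_eq0 : forall x y, dist x y = 0 <-> x = y;
  dist_sym : forall x y, dist x y = dist y x;
  dist_triangle : forall x y z, dist x z <= dist x y + dist y z;
  dist_nbhs : forall x : X, nbhs x =
    filter_from [set e : R | 0 < e] (fun e => [set y | dist x y < e]);
  dist_complete : forall u : nat -> X,
    (forall e : R, 0 < e -> exists N, forall m n,
       (N <= m)%N -> (N <= n)%N -> dist (u m) (u n) < e) ->
    exists l : X, u n @[n --> \oo] --> l;
  pt_dense : forall x e, 0 < e -> exists i, dist (pt i) x < e }.

Lemma polish_dense_metric (R : realType) (X : ptopologicalType) :
  polish R X -> inhabited (dense_metric R X).
Proof.
move=> [[D /countable_injP[f fi] dD] [d [d0 ds dt dn dc]]].
(* [p] inverts the injection [f] on [D]; an index missed by [f] gets the default [point], which only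
   adds one more centre. *)
pose p n : X := xget point [set x | D x /\ f x = n].
apply: inhabits; apply: (@DenseMetric _ _ d p) => // x e e0.
have [||y [/= xy Dy]] := dD ([set y | d x y < e]^°).
- by exists x; rewrite /interior /= dn; exists e.
- exact: open_interior.
exists (f y); rewrite /p; case: xgetP => [z _ [Dz fzy]|/(_ y)[]//].
have -> : z = y by apply: fi => //; rewrite inE.
by rewrite ds; move: xy => /interior_subset.
Qed.

Section dense_metric.
Context (R : realType) (X : ptopologicalType) (M : dense_metric R X).
Local Notation d := (dist M).
Local Notation p := (pt M).

Definition pt_ball (k i : nat) : set X := [set y | d (p i) y < k.+1%:R^-1].

Lemma dist_xx x : d x x = 0. Proof. exact/dist_eq0. Qed.

Lemma dist_ge0 x y : 0 <= d x y.
Proof.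
have := dist_triangle M x y x; rewrite dist_xx (dist_sym M y x) -mulr2n.
by rewrite pmulrn_lge0.
Qed.

Lemma open_distP (U : set X) :
  open U <-> forall x, U x -> exists2 e, 0 < e & [set y | d x y < e] `<=` U.
Proof.
rewrite openE; split=> UU x /UU; last by rewrite /interior (dist_nbhs M).
by rewrite /interior (dist_nbhs M).
Qed.

Lemma open_pt_ball k i : open (pt_ball k i).
Proof.
apply/open_distP => x /= ix; exists (k.+1%:R^-1 - d (p i) x); first by rewrite subr_gt0.
by move=> y /= xy; rewrite /pt_ball /= (le_lt_trans (dist_triangle M _ x _))// -ltrBrDl.
Qed.

Lemma exists_pt_ball k x : exists i, pt_ball k i x.
Proof. by apply: pt_dense; rewrite invr_gt0. Qed.

(** A ball of radius below [e / 2] that contains [x] stays within [e] of [x], so these countably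
    many balls form a base. *)
Lemma open_pt_ball_bigcup (U : set X) : open U ->
  U = \bigcup_(ki in [set ki : nat * nat | pt_ball ki.1 ki.2 `<=` U]) pt_ball ki.1 ki.2.
Proof.
move=> /open_distP oU; apply/seteqP; split=> [x Ux|x [ki /= + kix]]; last exact.
have [e e0 eU] := oU x Ux.
have [k] := ltr_add_invr (divr_gt0 e0 (ltr0n _ 2)); rewrite add0r => ke.
have [i ix] := exists_pt_ball k x.
exists (k, i) => //= y iy; apply: eU => /=.
rewrite (le_lt_trans (dist_triangle M _ (p i) _))// (splitr e).
by rewrite ltrD// ?(lt_trans _ ke)// dist_sym.
Qed.

(** A ball of radius below half of [d x y] cannot contain both points. This countable separation
    turns countably many almost-everywhere set identities into equality of maps. *)
Lemma pt_ball_separated x y : (forall k i, pt_ball k i x -> pt_ball k i y) -> x = y.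
Proof.
move=> xy; apply/(dist_eq0 M)/eqP; rewrite eq_le dist_ge0 andbT leNgt.
apply/negP => dxy.
have [k] := ltr_add_invr (divr_gt0 dxy (ltr0n _ 2)); rewrite add0r => kd.
have [i ix] := exists_pt_ball k x; have iy := xy _ _ ix.
suff : d x y < d x y by rewrite ltxx.
rewrite {2}(splitr (d x y)) (le_lt_trans (dist_triangle M _ (p i) _))//.
by rewrite ltrD// ?(lt_trans _ kd)// dist_sym.
Qed.

Lemma measurable_pt_ball k i : measurable (pt_ball k i : set (borel X)).
Proof. by apply: sub_sigma_algebra; exact: open_pt_ball. Qed.

Lemma measurable_point x : measurable ([set x] : set (borel X)).
Proof.
rewrite (_ : [set x] = \bigcap_(ki in [set ki : nat * nat | pt_ball ki.1 ki.2 x])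
  pt_ball ki.1 ki.2); last first.
  apply/seteqP; split=> [_ -> //|y xy].
  by apply/esym/pt_ball_separated => k i ix; exact: (xy (k, i) ix).
by apply: (@bigcap_count_measurable _ (borel X)) => ki; exact: measurable_pt_ball.
Qed.

End dense_metric.

(** * Measurable left inverses from completeness *)

Section left_inverse.
Context (R : realType) (X : ptopologicalType) (M : dense_metric R X).
Context d' (Z : measurableType d').
Variables (mu : {measure set (borel X) -> \bar R}) (f : borel X -> Z).
Local Notation d := (dist M).
Local Notation p := (pt M).
Local Notation rad k := (k.+1%:R^-1 : R).

Let rad_small (e : R) : 0 < e -> exists N, forall n, (N <= n)%N -> rad n < e.
Proof.
move=> e0; have [N] := ltr_add_invr e0; rewrite add0r => Ne.
by exists N => n Nn; apply: le_lt_trans Ne; rewrite lef_pV2 ?posrE// ler_nat.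
Qed.

Section limit_point.
Variable E : nat * nat -> set Z.

(** In [ae_left_inverse], [f^-1(E (k, i))] is up to a null set the ball of centre
    [p i] and radius [rad k]; coherence of [z] says that the balls whose [E]
    contains [z] shrink to a point. *)
Definition coherent : set Z :=
  [set z | (forall k, exists i, E (k, i) z) /\
    forall q : (nat * nat) * (nat * nat),
      rad q.1.1 + rad q.2.1 < d (p q.1.2) (p q.2.2) -> ~ (E q.1 z /\ E q.2 z)].

(** For coherent [z] the closed balls have exactly one common point, since their radii tend to 0;
    the constant value elsewhere keeps the map measurable. *)
Definition limit_point (z : Z) : X :=
  if z \in coherent then
    xget point [set s | forall ki, E ki z -> d (p ki.2) s <= rad ki.1]
  else point.

(** Choose one centre [p (i k)] for each radius. Coherence bounds the distances between centres by
    sums of radii, so these form a Cauchy sequence, and its limit meets every constraint. *)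
Lemma limit_pointP z : coherent z ->
  forall ki, E ki z -> d (p ki.2) (limit_point z) <= rad ki.1.
Proof.
move=> Cz; rewrite /limit_point mem_set//.
apply: (@xgetPex _ point [set s | forall ki, E ki z -> d (p ki.2) s <= rad ki.1]).
have [/choice[i Ei] coh] := Cz.
have closeness k l j : E (k, j) z -> d (p j) (p (i l)) <= rad k + rad l.
  move=> Ekj; rewrite leNgt; apply/negP => /(coh ((k, j), (l, i l))); apply.
  by split; last exact: Ei.
have [e e0|l cvl] := @dist_complete _ _ M (fun k => p (i k)).
  have [N NP] := rad_small (divr_gt0 e0 (ltr0n _ 2)).
  exists N => m n Nm Nn; rewrite (le_lt_trans (closeness _ _ _ (Ei m)))//.
  by rewrite (splitr e) ltrD// NP.
exists l => -[k j] Ekj; apply/ler_addgt0Pr => e e0 /=.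
have e20 := divr_gt0 e0 (ltr0n R 2).
have [N1 NP] := rad_small e20.
have : nbhs l [set y | d l y < e / 2] by rewrite (dist_nbhs M); exists (e / 2).
move=> /cvl[N2 _ N2P].
have NP1 := NP _ (leq_maxl N1 N2); have NP2 := N2P _ (leq_maxr N1 N2).
rewrite (le_trans (dist_triangle M _ (p (i (maxn N1 N2))) _))//.
rewrite (le_trans (lerD (closeness _ (maxn N1 N2) _ Ekj) (lexx _)))//.
by rewrite (splitr e) addrA lerD ?lerD// ltW// dist_sym.
Qed.

Hypothesis mE : forall ki, measurable (E ki).

Lemma measurable_coherent : measurable coherent.
Proof.
rewrite (_ : coherent = (\bigcap_k \bigcup_i E (k, i)) `&`
   \bigcap_(q in [set q : (nat * nat) * (nat * nat) |
      rad q.1.1 + rad q.2.1 < d (p q.1.2) (p q.2.2)]) ~` (E q.1 `&` E q.2)).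
  apply: measurableI.
    by apply: bigcapT_measurable => k; exact: bigcupT_measurable.
  by apply: bigcap_count_measurable => q; exact/measurableC/measurableI.
apply/seteqP; split=> z [] h1 h2; split=> //.
- by move=> k _; have [i] := h1 k; exists i.
- by move=> k; have [i _] := h1 k I; exists i.
Qed.

(** For coherent [z] the limit lies in an open [U] exactly when [z] is in [E ki] for some closed
    ball [ki] inside [U], a countable condition. *)
Lemma measurable_limit_point : measurable_fun setT (limit_point : Z -> borel X).
Proof.
apply: (@measurability _ _ Z (borel X) setT limit_point (@open X)) => //.
move=> _ [U oU <-]; rewrite setTI.
rewrite (_ : _ @^-1` U = (coherent `&`
    \bigcup_(ki in [set ki : nat * nat | [set y | d (p ki.2) y <= rad ki.1] `<=` U]) E ki)
  `|` (~` coherent `&` [set z | U point])).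
  apply: measurableU; apply: measurableI.
  - exact: measurable_coherent.
  - exact: bigcup_count_measurable.
  - exact/measurableC/measurable_coherent.
  - have [Up|nUp] := pselect (U point).
    + by rewrite (_ : mkset _ = setT)//; apply/seteqP; split.
    + by rewrite (_ : mkset _ = set0)//; apply/seteqP; split.
apply/seteqP; split=> z /=.
- have [Cz|nCz] := pselect (coherent z); last first.
    by rewrite /limit_point memNset//; right.
  move=> Us; left; split=> //.
  have [e e0 eU] := (open_distP M U).1 oU _ Us.
  have [k kP] := rad_small (divr_gt0 e0 (ltr0n _ 2)).
  have [/(_ k)[i Eki] _] := Cz.
  exists (k, i) => //= y iy; apply: eU => /=.
  rewrite (le_lt_trans (dist_triangle M _ (p i) _))// (splitr e).
  rewrite ltrD// ?(le_lt_trans iy) ?kP// dist_sym.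
  by rewrite (le_lt_trans (limit_pointP Cz Eki)) ?kP.
- move=> [[Cz [ki /= kiU Ekiz]]|[nCz Up]]; last by rewrite /limit_point memNset.
  by apply: kiU => /=; exact: limit_pointP.
Qed.

End limit_point.

(** Off a single null set, [f x] lies in [E (k, i)] exactly when [x] lies in the corresponding ball.
    Then [f x] is coherent, and [x] and the limit point of [f x] are both within [rad k] of a common
    centre for every [k], so they coincide. *)
Lemma ae_left_inverse : (forall U : set X, open U -> ae_pullback mu f U) ->
  exists2 g : Z -> borel X, measurable_fun setT g & g \o f = id %[ae mu].
Proof.
move=> fU.
have /choice[E EP] : forall ki : nat * nat, exists B, measurable B /\
    \forall x \ae mu, B (f x) <-> pt_ball M ki.1 ki.2 x.
  by move=> ki; have [B mB BP] := fU _ (open_pt_ball M ki.1 ki.2); exists B.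
exists (limit_point E); first by apply: measurable_limit_point => ki; have [] := EP ki.
have : \forall x \ae mu, forall k i, E (k, i) (f x) <-> pt_ball M k i x.
  by apply: ae_foralln => k; apply: ae_foralln => i; have [] := EP (k, i).
apply: filterS => x Ex _ /=.
have Cfx : coherent E (f x).
  split=> [k|[[k i] [l j]] /=].
    by have [i ix] := exists_pt_ball M k x; exists i; exact/Ex.
  rewrite ltNge => /negP + [/Ex ix /Ex jx]; apply.
  rewrite (le_trans (dist_triangle M _ x _))// lerD// ltW//.
  by rewrite dist_sym; exact: jx.
apply/(dist_eq0 M)/eqP; rewrite eq_le dist_ge0 andbT leNgt.
apply/negP => dx.
have [k kP] := rad_small (divr_gt0 dx (ltr0n _ 2)).
have [i ix] := exists_pt_ball M k x.
have := limit_pointP Cfx (iffRL (Ex k i) ix) => /= is_.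
suff : d (limit_point E (f x)) x < d (limit_point E (f x)) x by rewrite ltxx.
rewrite {2}(splitr (d _ x)) (le_lt_trans (dist_triangle M _ (p i) _))//.
by rewrite ltrD// ?(lt_trans ix) ?kP// dist_sym (le_lt_trans is_) ?kP.
Qed.

End left_inverse.

(** * Null sets and inverses of measure preserving maps *)

Lemma measurable_preimage d d' (X : measurableType d) (Z : measurableType d')
    (f : X -> Z) (B : set Z) :
  measurable_fun setT f -> measurable B -> measurable (f @^-1` B).
Proof. by move=> mf mB; rewrite -[X in measurable X]setTI; exact: mf. Qed.

Section ae_iff.
Context d (X : measurableType d) (R : realType) (mu : {measure set X -> \bar R}).
Local Open Scope ereal_scope.

Lemma ae_iff_setY (A B : set X) : measurable A -> measurable B ->
  (\forall x \ae mu, A x <-> B x) <-> mu (A `+` B) = 0.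
Proof.
move=> mA mB; have N0 := negligibleP mu (measurableY mA mB).
split=> [AB|/N0].
  apply/N0; apply: negligibleS AB; rewrite setY_def => x /=.
  by move=> [[Ax nBx]|[Bx nAx]] [AB BA]; auto.
rewrite setY_def; apply: negligibleS => x /= nAB.
apply: contrapT => nU; apply: nAB; split=> ?; apply: contrapT => ?; apply: nU.
  by left.
by right.
Qed.

Lemma ae_iff_measure (A B : set X) : measurable A -> measurable B ->
  (\forall x \ae mu, A x <-> B x) -> mu A = mu B.
Proof. by move=> mA mB /ae_iff_setY AB; apply: measureY0_eq => //; exact: AB. Qed.

End ae_iff.

Section measure_preserving.
Context d d' (X : measurableType d) (Z : measurableType d') (R : realType).
Variables (mu : {measure set X -> \bar R}) (nu : {measure set Z -> \bar R}).
Local Open Scope ereal_scope.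

Variables (f : X -> Z).
Hypotheses (mf : measurable_fun setT f) (fp : measure_preserving mu nu f).

Lemma ae_preimage (P : Z -> Prop) :
  (\forall z \ae nu, P z) -> \forall x \ae mu, P (f x).
Proof.
move=> [N [mN N0 PN]]; exists (f @^-1` N); split.
- exact: measurable_preimage.
- by rewrite fp.
- by move=> x; exact: PN.
Qed.

Variable g : Z -> X.
Hypotheses (mg : measurable_fun setT g) (gf : g \o f = id %[ae mu]).

(** The [nu]-measure of [g^-1(A)] is the [mu]-measure of [f^-1(g^-1(A))], which is [A] up to a null
    set. *)
Lemma measure_preserving_left_inverse : measure_preserving nu mu g.
Proof.
move=> A mA; rewrite -fp; last exact: measurable_preimage.
apply: ae_iff_measure => //.
  by do 2 apply: measurable_preimage => //.
by apply: filterS gf => x /(_ I) /= gfx; rewrite /preimage /= gfx.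
Qed.

(** Null sets of [Z] are detected by pulling back along [f], and there the claim becomes
    [f \o g \o f = f] almost everywhere. *)
Lemma ae_right_inverse_set (B : set Z) : measurable B ->
  \forall z \ae nu, B (f (g z)) <-> B z.
Proof.
move=> mB; have mfgB : measurable ((f \o g) @^-1` B).
  by apply: measurable_preimage => //; exact: measurableT_comp.
apply/ae_iff_setY => //; rewrite -fp; last exact: measurableY.
rewrite (_ : f @^-1` _ = f @^-1` ((f \o g) @^-1` B) `+` f @^-1` B); last first.
  by rewrite !setY_def.
apply/ae_iff_setY; [exact: measurable_preimage|exact: measurable_preimage|].
by apply: filterS gf => x /(_ I) /= gfx; rewrite /preimage /= gfx.
Qed.

Lemma ae_right_inverse (B : nat -> nat -> set Z) : (forall k i, measurable (B k i)) ->
  (forall x y, (forall k i, B k i x -> B k i y) -> x = y) ->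
  f \o g = id %[ae nu].
Proof.
move=> mB sB.
have : \forall z \ae nu, forall k i, B k i (f (g z)) <-> B k i z.
  by apply: ae_foralln => k; apply: ae_foralln => i; exact: ae_right_inverse_set.
by apply: filterS => z BP _; apply: sB => k i /BP.
Qed.

End measure_preserving.

Section msmap.
Local Open Scope quotient_scope.
Context d d' (X : measurableType d) (Y : measurableType d') (R : realType).
Variables (mu : {measure set X -> \bar R}) (nu : {measure set Y -> \bar R}).
Local Open Scope ereal_scope.

Lemma measurable_msmap (T : msmap mu nu) : measurable_fun setT (val T).
Proof. exact: measurable_funPT (repr (val T)). Qed.

Lemma msmap_measure_preserving (T : msmap mu nu) : measure_preserving mu nu (val T).
Proof. exact: set_valP T. Qed.

Lemma exists_msmap (f : X -> Y) :
  measurable_fun setT f -> measure_preserving mu nu f ->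
  exists T : msmap mu nu, val T = f %[ae mu].
Proof.
move=> mf fp.
pose F : {mfun X >-> Y} := HB.pack f (isMeasurableFun.Build _ _ _ _ f mf).
have FT : msmap mu nu (\pi_{mfun_ mu, X >-> Y} F) by exact/pi_msmap.
exists (SigSub (mem_set FT)) => /=; apply/asboolP.
by rewrite -[is_true _]/(is_true (ae_eq_op mu _ F)); apply/eqmodP; rewrite reprK.
Qed.

End msmap.

Section isomorphism.
Context (R : realType) (X Y : ptopologicalType).
Variables (MX : dense_metric R X) (MY : dense_metric R Y).
Variables (mu : {measure set (borel X) -> \bar R})
  (nu : {measure set (borel Y) -> \bar R}).

Lemma msmap_isomorphism_pullback (T : msmap_space mu nu) :
  (forall U : set X, open U -> ae_pullback mu (val (T : msmap mu nu)) U) ->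
  msmap_isomorphism mu nu T.
Proof.
move=> TU; set f := val (T : msmap mu nu) : borel X -> borel Y.
have mf : measurable_fun setT f := measurable_msmap T.
have fp : measure_preserving mu nu f := msmap_measure_preserving T.
have [g mg gf] := ae_left_inverse MX TU.
have gp := measure_preserving_left_inverse mf fp mg gf.
have fg : f \o g = id %[ae nu].
  apply: (ae_right_inverse mf fp mg gf (B := pt_ball MY)).
  - exact: measurable_pt_ball.
  - exact: pt_ball_separated.
have [S Sg] := exists_msmap mg gp.
exists S; split.
(* [S] agrees with [g] only off a [nu]-null set, whose preimage under [f] is [mu]-null. *)
- have := ae_preimage mf fp Sg.
  by apply: filterS2 gf => x /(_ I) /= gfx /(_ I) Sfx _ /=; rewrite Sfx.
- by apply: filterS2 fg Sg => y /(_ I) /= fgy /(_ I) Sy _ /=; rewrite Sy.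
Qed.

End isomorphism.

(** * Isomorphisms as a G_delta set *)

Section approximable.
Context d d' (X : measurableType d) (Y : measurableType d') (R : realType).
Variables (mu : {measure set X -> \bar R}) (nu : {measure set Y -> \bar R}).
Local Open Scope ereal_scope.

(** A quantitative form of [ae_pullback]. The set [E] has finite measure because the topology
    controls only preimages of such sets. *)
Definition approximable (A : set X) (e : R) : set (msmap_space mu nu) :=
  [set T : msmap mu nu | exists2 E, fin_meas nu E & mu (val T @^-1` E `+` A) < e%:E].

(** The [E] chosen for [T] also serves every [S] for which [S^-1(E)] is closer to [T^-1(E)] than the
    slack in the strict inequality. *)
Lemma open_approximable (A : set X) (e : R) : measurable A -> open (approximable A e).
Proof.
move=> mA; rewrite openE => T [E finE TEA]; rewrite /interior.
have [mE fE] := finE.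
have mS (S : msmap mu nu) : measurable (val S @^-1` E).
  by apply: measurable_preimage => //; exact: measurable_msmap.
have TEAfin : mu (val (T : msmap mu nu) @^-1` E `+` A) \is a fin_num.
  by rewrite ge0_fin_numE// (lt_trans TEA)// ltry.
have /cvg_msmap_spaceP/(_ (SigSub (mem_set finE))) : nbhs T --> T by exact: cvg_id.
move/cvgrPdist_lt => /(_ (e - fine (mu (val (T : msmap mu nu) @^-1` E `+` A)))%R).
rewrite subr_gt0 -lte_fin fineK// => /(_ TEA).
apply: filterS => S /=; rewrite sub0r normrN ger0_norm ?fine_ge0// => STE.
exists E => //; apply: le_lt_trans (measureY_triangle mu (mS S) (mS T) mA) _.
have fS (S' : msmap mu nu) : fin_meas mu (val S' @^-1` E).
  by split; rewrite // msmap_measure_preserving.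
move: STE; rewrite ltrBrDr -lte_fin EFinD !fineK//.
exact: (fin_measY (SigSub (mem_set (fS S))) (SigSub (mem_set (fS T)))).
Qed.

(** Borel-Cantelli: the errors are summable, so almost every [x] lies in only finitely many of the
    symmetric differences, and the limit superior of the [E k] pulls back to [A]. *)
Lemma ae_pullback_approximable (T : msmap mu nu) (A : set X) : measurable A ->
  (forall k, approximable A (2 ^ k.+1)%:R^-1 T) -> ae_pullback mu (val T) A.
Proof.
move=> mA TA.
have /choice[E EP] : forall k, exists E, measurable E /\
    mu (val T @^-1` E `+` A) <= ((2 ^ k.+1)%:R^-1)%:E.
  by move=> k; have [E [mE _] /ltW EA] := TA k; exists E.
have mTE k : measurable (val T @^-1` E k).
  by apply: measurable_preimage; [exact: measurable_msmap|have [] := EP k].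
exists (lim_sup_set E).
  apply: bigcapT_measurable => n; apply: bigcup_measurable => k _.
  by have [] := EP k.
have N0 : mu (lim_sup_set (fun k => val T @^-1` E k `+` A)) = 0.
  apply: lim_sup_set_cvg0 => [k|]; first exact: measurableY.
  apply: le_lt_trans (ltry 1).
  apply: le_trans (epsilon_trick0 xpredT ler01).
  by apply: lee_nneseries => // k _; have [_] := EP k; rewrite div1r.
have /negligibleP : mu (lim_sup_set (fun k => val T @^-1` E k `+` A)) = 0 by [].
move=> /(_ _) [].
  apply: bigcapT_measurable => n; apply: bigcup_measurable => k _.
  exact: measurableY.
move=> N [mN NN0 PN]; exists N; split => // x /= nx; apply: PN.
apply: contrapT => Px; apply: nx.
have [n nP] : exists n, forall k, (n <= k)%N -> ~ (val T @^-1` E k `+` A) x.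
  apply: contrapT => nex; apply: Px => n _; apply: contrapT => nU; apply: nex.
  by exists n => k nk EAx; apply: nU; exists k.
have {}nP k : (n <= k)%N -> E k (val T x) <-> A x.
  move=> /nP; rewrite setY_def => nU; split=> h; apply: contrapT => h'; apply: nU.
    by left.
  by right.
split=> [/(_ n I)[k /= nk Ek]|Ax m _]; first exact/(nP k).
by exists (maxn m n); [exact: leq_maxl|apply/nP => //; exact: leq_maxr].
Qed.

(** The preimage of [A] under the inverse [S] approximates with error 0. *)
Lemma isomorphism_approximable (A : set X) (e : R) : fin_meas mu A -> (0 < e)%R ->
  msmap_isomorphism mu nu `<=` approximable A e.
Proof.
move=> [mA fA] e0 T [S [ST _]]; set f := val (T : msmap mu nu) in ST *.
have mSA : measurable (val S @^-1` A).
  by apply: measurable_preimage => //; exact: measurable_msmap.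
exists (val S @^-1` A); first by split; rewrite // msmap_measure_preserving.
rewrite (_ : mu _ = 0)//; apply/ae_iff_setY => //.
  by apply: measurable_preimage => //; exact: measurable_msmap.
by apply: filterS ST => x /(_ I) /= STx; rewrite /preimage /= STx.
Qed.

End approximable.

Lemma Gdelta_bigcap_count (T : topologicalType) (J : countType) (F : J -> set T) :
  (forall i, open (F i)) -> Gdelta (\bigcap_i F i).
Proof.
move=> oF; exists (fun n => if unpickle n is Some i then F i else setT).
  by move=> n; case: unpickle => [i|]; [exact: oF|exact: openT].
apply/seteqP; split=> x Fx => [n _|i _]; first by case: unpickle => // i; exact: Fx.
by have := Fx (pickle i) I; rewrite pickleK.
Qed.

Lemma Gdelta_isomorphism (R : realType) (X Y : ptopologicalType)
    (MX : dense_metric R X) (MY : dense_metric R Y)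
    (mu : {measure set (borel X) -> \bar R})
    (nu : {measure set (borel Y) -> \bar R}) :
  sigma_finite setT mu -> Gdelta (msmap_isomorphism mu nu).
Proof.
move=> [F TF FP].
(* cut down by F, the basic balls generate the Borel sets and have finite measure *)
pose A (q : nat * nat * nat) : set (borel X) := pt_ball MX q.1.1 q.1.2 `&` F q.2.
have mA q : measurable (A q).
  by apply: measurableI; [exact: measurable_pt_ball|have [] := FP q.2].
have fA q : (mu (A q) < +oo)%E.
  have [mF fF] := FP q.2; apply: le_lt_trans fF.
  by apply: le_measure; rewrite ?inE; [exact: mA|exact: mF|exact: subIsetr].
rewrite (_ : msmap_isomorphism mu nu = \bigcap_(q : (nat * nat * nat) * nat)
    (approximable (A q.1) (2 ^ q.2.+1)%:R^-1 : set (msmap_space mu nu))).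
  by apply: Gdelta_bigcap_count => q; exact: open_approximable.
apply/seteqP; split=> [T Ti q _|T TA].
  apply: isomorphism_approximable Ti; first by split; [exact: mA|exact: fA].
  by rewrite invr_gt0 ltr0n expn_gt0.
apply: (msmap_isomorphism_pullback MX MY) => U oU.
pose G := [set V | exists q, V = A q].
apply: (@ae_pullback_sigma _ _ _ _ _ mu _ G).
  move=> _ [q ->]; apply: ae_pullback_approximable => // k.
  exact: (TA (q, k)).
rewrite (open_pt_ball_bigcup MX oU).
apply: (@bigcup_count_measurable _ (g_sigma_algebraType G)) => ki.
rewrite (_ : pt_ball MX ki.1 ki.2 = \bigcup_m A (ki, m)).
  by apply: (@bigcupT_measurable _ (g_sigma_algebraType G)) => m;
    apply: sub_sigma_algebra; exists (ki, m).
by rewrite -[LHS]setIT TF setI_bigcupr.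
Qed.

(** * Coding countably many sets by a ternary expansion *)

Section ternary.
Context d (T : measurableType d) (R : realType) (U : nat -> set T).

(** The starting digit [n] is a parameter so that the tail of an expansion is again one of the same
    form. *)
Fixpoint ternary_sum (N n : nat) (x : T) : R :=
  if N is N'.+1 then (2 * \1_(U n) x + ternary_sum N' n.+1 x) / 3 else 0.

(** The ternary expansion with digits 0 and 2 given by [U n], [U n.+1], ...:
    unlike binary expansions, it determines its digits. *)
Definition ternary (n : nat) (x : T) : R := limn (fun N => ternary_sum N n x).

Lemma ternary_sum_ge0 N n x : 0 <= ternary_sum N n x.
Proof.
by elim: N n => //= N IH n; rewrite divr_ge0// addr_ge0// mulr_ge0// indicE.
Qed.

Lemma ternary_sum_le1 N n x : ternary_sum N n x <= 1.
Proof.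
elim: N n => /= [n|N IH n]; first exact: ler01.
rewrite ler_pdivrMr// mul1r; have := IH n.+1.
by rewrite indicE; case: (_ \in _) => /=; lra.
Qed.

Lemma ternary_sum_nd n x : nondecreasing_seq (fun N => ternary_sum N n x).
Proof.
apply/nondecreasing_seqP => N.
elim: N n => [n|N IH n]; first exact: ternary_sum_ge0.
by rewrite [leLHS]/= [leRHS]/= ler_pM2r// lerD2l; exact: IH.
Qed.

Lemma ternary_cvg n x : ternary_sum N n x @[N --> \oo] --> ternary n x.
Proof.
apply: nondecreasing_is_cvgn; first exact: ternary_sum_nd.
by exists 1 => _ [N _ <-]; exact: ternary_sum_le1.
Qed.

Lemma ternary_ge0 n x : 0 <= ternary n x.
Proof.
apply: (cvgr_to_ge (@ternary_cvg n x)).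
by apply: nearW => N; exact: ternary_sum_ge0.
Qed.

Lemma ternary_le1 n x : ternary n x <= 1.
Proof.
apply: (cvgr_to_le (@ternary_cvg n x)).
by apply: nearW => N; exact: ternary_sum_le1.
Qed.

Lemma ternaryS n x : ternary n x = (2 * \1_(U n) x + ternary n.+1 x) / 3.
Proof.
have := @ternary_cvg n x; rewrite -cvg_shiftS => /cvg_unique; apply => //.
apply: cvgMr_tmp; apply: cvgD; [exact: cvg_cst|exact: ternary_cvg].
Qed.

Hypothesis mU : forall n, measurable (U n).

Lemma measurable_ternary n : measurable_fun setT (ternary n).
Proof.
apply: (@measurable_fun_cvg _ _ _ setT (fun N => ternary_sum N n)); last first.
  by move=> x _; exact: ternary_cvg.
move=> N; elim: N n => [n|N IH n] /=; first exact: measurable_cst.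
apply: measurable_funM => //; apply: measurable_funD => //.
by apply: measurable_funM => //; exact: measurable_indic.
Qed.

(** Deletes the leading digit of a value of [ternary], read off by comparison with 2/3. *)
Definition ternary_shift (t : R) : R := 3 * t - 2 * \1_(`[2 / 3, +oo[) t.

Fixpoint ternary_digit (n : nat) : set R :=
  if n is n'.+1 then ternary_shift @^-1` ternary_digit n' else `[2 / 3, +oo[.

Lemma measurable_ternary_digit n : measurable (ternary_digit n).
Proof.
elim: n => [|n IH] /=; first exact: measurable_itv.
apply: measurable_preimage IH; apply: measurable_funB.
  exact: measurable_funM.
by apply: measurable_funM => //; exact: measurable_indic.
Qed.

(** The tail lies in [0, 1], so the value is at most 1/3 for digit 0 and at least 2/3 for digit
    2. *)
Lemma ternary_first n x : (2 / 3 <= ternary n x) = (x \in U n).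
Proof.
have := ternary_ge0 n.+1 x; have := ternary_le1 n.+1 x.
rewrite [ternary n x]ternaryS indicE; case: (x \in U n) => /= h0 h1.
  by apply/idP; lra.
by apply/negbTE; rewrite -ltNge; lra.
Qed.

Lemma ternary_shiftE n x : ternary_shift (ternary n x) = ternary n.+1 x.
Proof.
rewrite /ternary_shift indicE mem_setE in_itv/= andbT ternary_first.
by rewrite ternaryS indicE; lra.
Qed.

Lemma ternary_digitE n m : ternary m @^-1` ternary_digit n = U (m + n).
Proof.
elim: n m => [|n IH] m /=.
  rewrite addn0; apply/seteqP.
  split=> x; rewrite /preimage /= in_itv/= andbT ternary_first.
    by rewrite inE.
  by rewrite inE.
rewrite addnS -addSn -IH; apply/seteqP.
by split=> x; rewrite /preimage /= ternary_shiftE.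
Qed.

End ternary.

(** One real function remembers all the sets [U n]; when these separate points it is injective. *)
Lemma measurable_ternary_embedding d (T : measurableType d) (R : realType)
    (U : nat -> set T) : (forall n, measurable (U n)) ->
  exists u : T -> R, [/\ measurable_fun setT u, forall x, 0 <= u x <= 1 &
    forall n, exists2 B, measurable B & U n = u @^-1` B].
Proof.
move=> mU; exists (ternary R U 0); split.
- exact: measurable_ternary.
- by move=> x; rewrite ternary_ge0 ternary_le1.
- move=> n; exists (ternary_digit n); first exact: measurable_ternary_digit.
  by rewrite ternary_digitE.
Qed.

(** * Distribution functions without atoms *)

Section distribution_function.
Context d (X : measurableType d) (R : realType) (mu : {measure set X -> \bar R}).
Variable h : X -> R.
Hypotheses (mh : measurable_fun setT h) (h0 : forall x, 0 <= h x).
Local Open Scope ereal_scope.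
Hypotheses (hfin : forall t, mu [set x | (h x <= t)%R] < +oo)
  (hatom : forall t, mu [set x | h x = t] = 0).

Definition dfun (t : R) : R := fine (mu [set x | (h x <= t)%R]).

Let mle (t : R) : measurable [set x | (h x <= t)%R].
Proof.
rewrite (_ : mkset _ = h @^-1` `]-oo, t]%classic).
  by apply: measurable_preimage => //; exact: measurable_itv.
by apply/seteqP; split=> x; rewrite /preimage /= in_itv.
Qed.

Let mlt (t : R) : measurable [set x | (h x < t)%R].
Proof.
rewrite (_ : mkset _ = h @^-1` `]-oo, t[%classic).
  by apply: measurable_preimage => //; exact: measurable_itv.
by apply/seteqP; split=> x; rewrite /preimage /= in_itv.
Qed.

Lemma dfunE t : (dfun t)%:E = mu [set x | (h x <= t)%R].
Proof. by rewrite fineK// ge0_fin_numE. Qed.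

Lemma dfun_ge0 t : (0 <= dfun t)%R.
Proof. exact: fine_ge0. Qed.

Lemma dfun_le : {homo dfun : s t / (s <= t)%R}.
Proof.
move=> s t st; rewrite -lee_fin !dfunE; apply: le_measure; rewrite ?inE//.
by move=> x /= /le_trans; apply.
Qed.

Lemma measurable_dfun_comp : measurable_fun setT (dfun \o h).
Proof. by apply: measurableT_comp => //; exact: nondecreasing_measurable dfun_le. Qed.

Lemma dfun_leT t : (dfun t)%:E <= mu setT.
Proof. by rewrite dfunE; apply: le_measure; rewrite ?inE. Qed.

Lemma measure_lt_le t : mu [set x | (h x < t)%R] = mu [set x | (h x <= t)%R].
Proof.
rewrite (_ : [set x | (h x <= t)%R] = [set x | (h x < t)%R] `|` [set x | h x = t]).
  rewrite measureU//=; first by rewrite hatom adde0.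
    rewrite (_ : mkset _ = h @^-1` [set t]) //; apply: measurable_preimage => //.
  by apply/seteqP; split=> // x [/= + xt]; rewrite xt ltxx.
apply/seteqP; split=> x /=; first by rewrite le_eqVlt => /predU1P[|]; [right|left].
by move=> [/ltW|->].
Qed.

(** Nonatomicity makes [dfun] continuous, so that its sublevel sets are closed. *)
Lemma dfun_sublevel (s : R) : (0 <= s)%R -> s%:E < mu setT ->
  exists2 t, (forall r, (dfun r <= s)%R = (r <= t)%R) & dfun t = s.
Proof.
move=> s0 smu.
pose A := [set r | (dfun r <= s)%R].
(* The sets [h x <= n] exhaust [X], so by continuity from below some [dfun N] exceeds [s]; this [N]
   bounds [A] from above. *)
have [N NP] : exists N : nat, (s < dfun N%:R)%R.
  apply: contrapT => nex; move: smu; apply/negP; rewrite -leNgt.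
  pose F (n : nat) := [set x | (h x <= n%:R)%R].
  have -> : setT = \bigcup_n F n.
    apply/seteqP; split=> // x _; exists (Num.truncn (h x)).+1 => //.
    exact/ltW/truncnS_gt.
  have cvF := nondecreasing_cvg_mu (mu := mu) (F := F) (fun=> mle _)
    (bigcupT_measurable _ (fun=> mle _)).
  apply: (cvge_to_le (cvF _)).
    apply/nondecreasing_seqP => n; apply/subsetPset => x /= /le_trans; apply.
    by rewrite ler_nat.
  apply: nearW => n /=; rewrite -dfunE lee_fin leNgt; apply/negP => sn.
  by apply: nex; exists n.
have supA : has_sup A.
  split.
    exists (-1)%R; rewrite /A /= /dfun (_ : mkset _ = set0) ?measure0//.
    by apply/seteqP; split=> // x /= xN1; have := h0 x; lra.
  exists N%:R => r /= rA; rewrite leNgt; apply/negP => /ltW /dfun_le.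
  by rewrite leNgt (le_lt_trans rA).
pose t := sup A.
have tS n : (s < dfun (t + n.+1%:R^-1))%R.
  rewrite ltNge; apply/negP => /(sup_ubound supA.2).
  by rewrite gerDl invr_le0 lern0.
(* Left continuity: the sets [h x <= t - 1/(n+1)] increase to [h x < t], which misses only a null
   level set of [h x <= t]. *)
have tles : (dfun t <= s)%R.
  rewrite -lee_fin dfunE -measure_lt_le.
  pose F (n : nat) := [set x | (h x <= t - n.+1%:R^-1)%R].
  have -> : [set x | (h x < t)%R] = \bigcup_n F n.
    apply/seteqP; split=> x /=.
      move=> /ltr_add_invr[k xk]; exists k => //; rewrite /F /=.
      by rewrite lerBrDr ltW.
    move=> [n _] /= /le_lt_trans; apply.
    by rewrite ltrBlDr ltrDl invr_gt0.
  have cvF := nondecreasing_cvg_mu (mu := mu) (F := F) (fun=> mle _)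
    (bigcupT_measurable _ (fun=> mle _)).
  apply: (cvge_to_le (cvF _)).
    apply/nondecreasing_seqP => n; apply/subsetPset => x /= /le_trans; apply.
    by rewrite lerD2l lerN2 lef_pV2 ?posrE// ler_nat.
  apply: nearW => n /=; rewrite -dfunE lee_fin.
  have [|r Ar tr] := @sup_adherent _ A n.+1%:R^-1 _ supA; first by rewrite invr_gt0.
  by apply: le_trans Ar; apply: dfun_le; exact: ltW.
(* Right continuity: the sets [h x <= t + 1/(n+1)] have finite measure and decrease to
   [h x <= t]. *)
have sle : (s <= dfun t)%R.
  rewrite -lee_fin dfunE.
  pose F (n : nat) := [set x | (h x <= t + n.+1%:R^-1)%R].
  have -> : [set x | (h x <= t)%R] = \bigcap_n F n.
    apply/seteqP; split=> x /=.
      by move=> xt n _; rewrite /F /= (le_trans xt)// lerDl.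
    move=> xF; rewrite leNgt; apply/negP => /ltr_add_invr[k].
    by rewrite ltNge => /negP; apply; exact: xF.
  have cvF := nonincreasing_cvg_mu (mu := mu) (F := F) (hfin _) (fun=> mle _)
    (bigcapT_measurable (fun=> mle _)).
  apply: (cvge_to_ge (cvF _)).
    apply/nonincreasing_seqP => n; apply/subsetPset => x /= /le_trans; apply.
    by rewrite lerD2l lef_pV2 ?posrE// ler_nat.
  by apply: nearW => n /=; rewrite -dfunE lee_fin ltW.
exists t; last by apply/eqP; rewrite eq_le tles.
move=> r; apply/idP/idP => [rs|/dfun_le /le_trans]; last exact.
exact: sup_ubound supA.2 _ rs.
Qed.

(** The probability integral transform: on sublevel sets, the image of [mu] under [dfun \o h] is
    Lebesgue measure on an interval of length [mu setT]. *)
Lemma measure_dfun_le (s : R) : (0 <= s)%R ->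
  mu [set x | (dfun (h x) <= s)%R] = mine s%:E (mu setT).
Proof.
move=> s0; have [smu|mus] := ltP s%:E (mu setT).
  have [t tP ts] := dfun_sublevel s0 smu.
  by rewrite -ts dfunE; congr (mu _); apply/seteqP; split=> x /=; rewrite ts tP.
congr (mu _); apply/seteqP; split=> // x _ /=.
by rewrite -lee_fin (le_trans (dfun_leT _)).
Qed.

(** [dfun] may be constant on intervals, so this holds only almost everywhere: the right-hand set
    lies in the left-hand one and both have the finite measure [dfun t]. *)
Lemma ae_dfun_le t : \forall x \ae mu, (dfun (h x) <= dfun t)%R <-> (h x <= t)%R.
Proof.
have mft : measurable [set x | (dfun (h x) <= dfun t)%R].
  rewrite (_ : mkset _ = (dfun \o h) @^-1` `]-oo, dfun t]%classic).
    by apply: measurable_preimage => //; exact: measurable_dfun_comp.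
  by apply/seteqP; split=> x; rewrite /preimage /= in_itv.
have sub : [set x | (h x <= t)%R] `<=` [set x | (dfun (h x) <= dfun t)%R].
  by move=> x /=; exact: dfun_le.
have mE : mu [set x | (dfun (h x) <= dfun t)%R] = mu [set x | (h x <= t)%R].
  by rewrite (measure_dfun_le (dfun_ge0 t)) (min_idPl (dfun_leT t)) dfunE.
exists ([set x | (dfun (h x) <= dfun t)%R] `\` [set x | (h x <= t)%R]); split.
- exact: measurableD.
- rewrite measureD//; last by move: (hfin t); rewrite -mE.
  rewrite setIidr// [X in (X - _)%E](mE : mu _ = _) subee// ge0_fin_numE//.
- move=> x /= nx; split=> [|xt]; last by apply: nx; split=> // _; exact: sub.
  by apply: contrapT => nfx; apply: nx; split=> [/nfx//|/sub].
Qed.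

(** Up to null sets [dfun \o h] keeps all the information in [h]: rays generate the Borel sets, and
    []t, +oo[] corresponds to []dfun t, +oo[]. *)
Lemma ae_pullback_dfun (B : set R) : measurable B ->
  ae_pullback mu (dfun \o h) (h @^-1` B).
Proof.
move=> mB.
suff : <<s @RGenOInfty.G R >> `<=` [set B | ae_pullback mu (dfun \o h) (h @^-1` B)].
  apply; move: mB.
  rewrite [measurable B](_ : _ = @measurable _ (g_sigma_algebraType (@ocitv R)) B)//.
  by rewrite RGenOInfty.measurableE.
have [S0 SD SU] := sigma_algebra_ae_pullback mu (dfun \o h).
apply: smallest_sub; first split.
- by rewrite /= preimage_set0.
- by move=> A /SD; rewrite /= !setTD preimage_setC.
- by move=> F mF; rewrite /= preimage_bigcup; exact: SU.
move=> _ [t ->]; exists (`]dfun t, +oo[%classic); first exact: measurable_itv.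
apply: filterS (ae_dfun_le t) => x [h1 h2].
rewrite /preimage /= !in_itv /= !andbT !ltNge.
by split=> /negP + ; [move=> nle; apply/negP => /h2|move=> nle; apply/negP => /h1].
Qed.

End distribution_function.

Lemma exists_pushforward d d' (X : measurableType d) (Z : measurableType d')
    (R : realType) (mu : {measure set X -> \bar R}) (f : X -> Z) :
  measurable_fun setT f ->
  exists m : {measure set Z -> \bar R}, forall B, m B = mu (f @^-1` B).
Proof.
by move=> mf; unshelve eexists (pushforward mu f : {measure set Z -> \bar R}).
Qed.

(** The rays []-oo, s]] are stable under intersection and generate the Borel sets, and those with
    [s] a natural number exhaust the line with finite measure. *)
Lemma eq_measure_preimage d d' (X : measurableType d) (Y : measurableType d')
    (R : realType) (mu : {measure set X -> \bar R}) (nu : {measure set Y -> \bar R})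
    (f : X -> R) (g : Y -> R) :
  measurable_fun setT f -> measurable_fun setT g ->
  (forall s, mu [set x | f x <= s] = nu [set y | g y <= s]) ->
  (forall s, (mu [set x | (f x <= s)%R] < +oo)%E) ->
  forall B, measurable B -> mu (f @^-1` B) = nu (g @^-1` B).
Proof.
move=> mf mg fg ffin B mB.
have [m1 m1E] := exists_pushforward mu mf.
have [m2 m2E] := exists_pushforward nu mg.
rewrite -m1E -m2E.
have rayE (T : Type) (u : T -> R) (s : R) :
    u @^-1` `]-oo, s]%classic = [set x | u x <= s].
  by apply/seteqP; split=> x; rewrite /preimage /= in_itv.
pose G : set (set R) := [set A | exists s, A = `]-oo, s]%classic].
have mG A : measurable A -> <<s G >> A.
  rewrite [measurable A](_ : _ = @measurable _ (g_sigma_algebraType (@ocitv R)) A)//.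
  rewrite RGenOInfty.measurableE.
  apply: smallest_sub; first exact: smallest_sigma_algebra.
  move=> _ [t ->]; rewrite -setCitvl; apply: (@measurableC _ (g_sigma_algebraType G)).
  by apply: sub_sigma_algebra; exists t.
apply: (measure_unique G (fun n => `]-oo, n%:R]%classic)) => //.
- apply/seteqP; split=> A; first exact: mG.
  apply: smallest_sub; first exact: sigma_algebra_measurable.
  by move=> _ [t ->]; exact: measurable_itv.
- move=> _ _ [s ->] [t ->]; exists (Num.min s t); apply/seteqP.
  by split=> x /=; rewrite !in_itv /= le_min => /andP.
- by move=> n; exists n%:R.
- apply/seteqP; split=> // x _; exists (Num.truncn x).+1 => //=.
  by rewrite in_itv /=; exact/ltW/truncnS_gt.
- by move=> _ [t ->]; rewrite m1E m2E !rayE.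
- by move=> n; rewrite m1E rayE.
Qed.

(** * Injective heights that order the fibres *)

Section height.
Context (R : realType) (X : ptopologicalType) (M : dense_metric R X).
Variable mu : {measure set (borel X) -> \bar R}.
Variable k : X -> nat.
Hypotheses (mk : forall n, measurable (k @^-1` [set n] : set (borel X)))
  (kfin : forall n, (mu (k @^-1` [set n]) < +oo)%E)
  (muP : forall x, mu [set x] = 0%E).

Lemma measurable_lt_fibres n : measurable ([set x | (k x < n)%N] : set (borel X)).
Proof.
rewrite (_ : mkset _ = \bigcup_(i in [set i | (i < n)%N]) (k @^-1` [set i])).
  by apply: (@bigcup_measurable _ (borel X)).
apply/seteqP; split=> x /=; first by move=> xn; exists (k x).
by move=> [i /= + ->].
Qed.

Lemma measure_lt_fibres_lty n : (mu [set x | (k x < n)%N] < +oo)%E.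
Proof.
elim: n => [|n IH]; first by rewrite (_ : mkset _ = set0) ?measure0// -subset0.
rewrite (_ : mkset _ = [set x | (k x < n)%N] `|` k @^-1` [set n]).
  apply: le_lt_trans (lte_add_pinfty IH (kfin n)).
  by apply: measureU2 => //; exact: measurable_lt_fibres.
apply/seteqP; split=> x /=.
  by rewrite ltnS leq_eqVlt => /predU1P[->|]; [right|left].
by move=> [xn|->]; rewrite ltnS// ltnW.
Qed.

(** The height is [2 k + u] with [u] a ternary coding of the basic balls. A sublevel set meets
    finitely many fibres, so its measure is finite; a level set has at most one point, so it is
    null. *)
Lemma exists_height : exists h : borel X -> R, [/\ measurable_fun setT h,
  forall x, 0 <= h x,
  forall t, (mu [set x | (h x <= t)%R] < +oo)%E,
  forall t, mu [set x | h x = t] = 0%E &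
  (forall n x, (h x <= n.*2%:R - 1) = (k x < n)%N) /\
  forall U : set X, open U -> exists2 B : set R, measurable B & U = h @^-1` B].
Proof.
pose V n : set (borel X) :=
  if unpickle n is Some ki then pt_ball M ki.1 ki.2 else setT.
have mV n : measurable (V n).
  by rewrite /V; case: unpickle => [ki|//]; exact: measurable_pt_ball.
have [u [mu_ u01 uV]] := measurable_ternary_embedding R mV.
(* the factor 2 keeps the fibres of k apart although u may take both values 0 and 1 *)
pose h (x : borel X) : R := (k x).*2%:R + u x.
have hmu (B : set R) : h @^-1` B = \bigcup_n (k @^-1` [set n] `&`
    ((fun x => n.*2%:R + u x) @^-1` B)).
  by apply/seteqP; split=> x /=; [exists (k x)|move=> [n _ [<-]]].
have mh : measurable_fun setT h.
  move=> _ B mB; rewrite setTI hmu; apply: bigcupT_measurable => n.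
  apply: measurableI => //; apply: measurable_preimage => //.
  exact: measurable_funD.
have kE n x : (n.*2%:R <= h x <= n.*2%:R + 1) -> k x = n.
  rewrite /h => /andP[nk kn]; have /andP[ux0 ux1] := u01 x.
  have : (n.*2%:R : R) <= (k x).*2.+1%:R by rewrite -natr1; lra.
  have : ((k x).*2%:R : R) <= n.*2.+1%:R by rewrite -natr1; lra.
  by rewrite !ler_nat; lia.
have hU (U : set X) : open U -> exists2 B : set R, measurable B & U = h @^-1` B.
  have hV i : exists2 B : set R, measurable B & V i = h @^-1` B.
    have [B mB ->] := uV i.
    (* The heights of fibre [n] lie in [2n, 2n+1]; the set that [u] pulls back to [V i] is
       translated into each of these strips. *)
    exists (\bigcup_n (`[n.*2%:R, n.*2%:R + 1] `&` (fun t => t - n.*2%:R) @^-1` B)).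
      apply: bigcupT_measurable => n; apply: measurableI; first exact: measurable_itv.
      by apply: measurable_preimage => //; exact: measurable_funB.
    apply/seteqP; split=> x /=.
      move=> Bx; exists (k x) => //; split=> /=.
        by rewrite in_itv /= /h; have := u01 x; lra.
      by rewrite /h addrC addKr.
    move=> [n _ [/=]]; rewrite in_itv /= => /(kE n) kn.
    by rewrite /h kn addrC addKr.
  move=> oU.
  pose P := [set i | if unpickle i is Some ki then pt_ball M ki.1 ki.2 `<=` U else False].
  have UE : U = \bigcup_(i in P) V i.
    rewrite {1}(open_pt_ball_bigcup M oU); apply/seteqP; split=> x.
      by move=> [ki /= kiU kix]; exists (pickle ki); rewrite /P /V /= pickleK.
    by move=> [i]; rewrite /P /V /=; case: unpickle => // ki kiU kix; exists ki.
  have /choice[B BP] : forall i, exists B : set R, measurable B /\ V i = h @^-1` B.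
    by move=> i; have [B mB ViB] := hV i; exists B.
  exists (\bigcup_(i in P) B i).
    by apply: bigcup_measurable => i _; have [] := BP i.
  by rewrite preimage_bigcup UE; apply: eq_bigcupr => i _; have [] := BP i.
(* Fibres below [n] have heights at most 2(n-1) + 1 = 2n - 1, the others at least 2n. *)
have hk n x : (h x <= n.*2%:R - 1) = (k x < n)%N.
  have /andP[ux0 ux1] := u01 x; have [kn|nk] := ltnP (k x) n.
    have : ((k x).*2.+2%:R : R) <= n.*2%:R by rewrite ler_nat; lia.
    by rewrite -2!natr1 /h => kn2; lra.
  have : (n.*2%:R : R) <= (k x).*2%:R by rewrite ler_nat; lia.
  by move=> nk2; apply/negbTE; rewrite -ltNge /h; lra.
exists h; split => //.
- by move=> x; rewrite addr_ge0//; have /andP[] := u01 x.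
- move=> t; have [n tn] : exists n : nat, t <= n.*2%:R - 1.
    exists (Num.truncn (`|t| + 1)).+1.
    have := truncnS_gt (`|t| + 1); set m := (Num.truncn _).+1 => tm.
    have : (m%:R : R) <= m.*2%:R by rewrite ler_nat; lia.
    by have := ler_norm t; lra.
  apply: le_lt_trans (measure_lt_fibres_lty n).
  apply: le_measure; rewrite ?inE.
  + rewrite (_ : mkset _ = h @^-1` `]-oo, t]%classic).
      by apply: measurable_preimage => //; exact: measurable_itv.
    by apply/seteqP; split=> x; rewrite /preimage /= in_itv.
  + exact: measurable_lt_fibres.
  + by move=> x /= xt; rewrite -hk (le_trans xt).
- move=> t; have [->|/set0P[x /= hx]] := eqVneq [set x | h x = t] set0.
    exact: measure0.
  rewrite (_ : mkset _ = [set x])//; apply/seteqP; split=> y /=; last by move=> ->.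
  move=> hy; apply/esym/(pt_ball_separated (M := M)) => j i.
  have [B _ ->] := hU _ (open_pt_ball M j i).
  by rewrite /preimage /= hx hy.
Qed.
End height.

(** A point of positive measure would be an atom, its only subsets being itself and the empty
    set. *)
Lemma nonatomic_point (R : realType) (X : ptopologicalType) (M : dense_metric R X)
    (mu : {measure set (borel X) -> \bar R}) (x : X) :
  nonatomic mu -> mu [set x] = 0%E.
Proof.
move=> na; apply/eqP; rewrite eq_le measure_ge0 andbT leNgt; apply/negP => mux.
apply: na; exists [set x]; split => //; first exact: (measurable_point M).
by move=> B mB /subset_set1[->|->]; [left; rewrite measure0|right].
Qed.

(** * Isomorphisms agreeing with a given map on a partition *)

Section approximation.
Context (R : realType) (X Y : ptopologicalType).
Variables (MX : dense_metric R X) (MY : dense_metric R Y).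
Variables (mu : {measure set (borel X) -> \bar R})
  (nu : {measure set (borel Y) -> \bar R}).
Hypotheses (muP : forall x, mu [set x] = 0%E) (nuP : forall y, nu [set y] = 0%E).

Lemma exists_isomorphism (T : borel X -> borel Y) (k : Y -> nat) :
  measurable_fun setT T -> measure_preserving mu nu T ->
  (forall n, measurable (k @^-1` [set n] : set (borel Y))) ->
  (forall n, (nu (k @^-1` [set n]) < +oo)%E) ->
  exists2 S : msmap mu nu, msmap_isomorphism mu nu S &
    \forall x \ae mu, k (val S x) = k (T x).
Proof.
move=> mT Tp mk kfin.
pose k' x := k (T x).
have mk' n : measurable (k' @^-1` [set n] : set (borel X)).
  exact: (measurable_preimage mT (mk n)).
have kfin' n : (mu (k' @^-1` [set n]) < +oo)%E.
  by rewrite -[X in mu X]/(T @^-1` (k @^-1` [set n])) Tp.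
have [h [mh h0 hfin hatom [hk hU]]] := exists_height MX mk' kfin' muP.
have [h' [mh' h0' hfin' hatom' [hk' hU']]] := exists_height MY mk kfin nuP.
pose f := dfun mu h \o h; pose f' := dfun nu h' \o h'.
have mf : measurable_fun setT f := measurable_dfun_comp mh hfin.
have mf' : measurable_fun setT f' := measurable_dfun_comp mh' hfin'.
have muT : mu setT = nu setT by rewrite -Tp.
have fs s : mu [set x | f x <= s] = nu [set y | f' y <= s].
  have [s0|s0] := leP 0 s.
    by rewrite !measure_dfun_le// muT.
  rewrite (_ : mkset _ = set0); last first.
    by apply/seteqP; split=> // x /=; rewrite leNgt (lt_le_trans s0)// dfun_ge0.
  rewrite [X in nu X](_ : _ = set0) ?measure0//.
  by apply/seteqP; split=> // x /=; rewrite leNgt (lt_le_trans s0)// dfun_ge0.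
(* the image measures agree, and agree with Lebesgue measure on [0, mu X] *)
have ff' (B : set R) : measurable B -> mu (f @^-1` B) = nu (f' @^-1` B).
  apply: eq_measure_preimage => // s.
  have [s0|s0] := leP 0 s.
    by rewrite measure_dfun_le// gt_min ltry.
  rewrite (_ : mkset _ = set0) ?measure0//.
  by apply/seteqP; split=> // x /=; rewrite leNgt (lt_le_trans s0)// dfun_ge0.
have [m mE] := exists_pushforward nu mf'.
have f'p : measure_preserving nu m f' by move=> B _; rewrite mE.
have fp : measure_preserving mu m f by move=> B mB; rewrite mE ff'.
(* [g] serves as the inverse of [f'], which recovers every open set of [Y] up to a null set. *)
have [g mg gf'] : exists2 g : R -> borel Y, measurable_fun setT g & g \o f' = id %[ae nu].
  apply: (ae_left_inverse MY) => U oU; have [B mB ->] := hU' U oU.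
  exact: ae_pullback_dfun.
have gp := measure_preserving_left_inverse mf' f'p mg gf'.
have mgf : measurable_fun setT (g \o f) by exact: measurableT_comp.
have gfp : measure_preserving mu nu (g \o f).
  by move=> B mB; rewrite -gp// -fp//; exact: measurable_preimage.
have f'gf (C : set R) : measurable C -> \forall x \ae mu, C (f' (g (f x))) <-> C (f x).
  by move=> mC; apply: (ae_preimage mf fp (ae_right_inverse_set mf' f'p mg gf' mC)).
have [S Sgf] := exists_msmap mgf gfp.
exists S.
  (* Up to null sets [U] is [f^-1(C)], and [f' \o S] and [f] lie in [C] together, so [U] is the
     pullback of [f'^-1(C)] along [S]. *)
  apply: (msmap_isomorphism_pullback MX MY) => U oU; have [B mB ->] := hU U oU.
  have [C mC CB] : ae_pullback mu f (h @^-1` B) by exact: ae_pullback_dfun.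
  exists (f' @^-1` C); first exact: measurable_preimage.
  apply: filterS3 CB (f'gf C mC) Sgf => x CB CC /(_ I) /= ->.
  exact: iff_trans CC CB.
(* Both sublevel sets at 2n - 1 consist of the fibres below [n], and the one in [X] is the preimage
   under [T] of the one in [Y]. *)
have dE n : dfun mu h (n.*2%:R - 1) = dfun nu h' (n.*2%:R - 1).
  rewrite /dfun; congr fine.
  rewrite (_ : [set y | h' y <= _] = [set y | (k y < n)%N]); last first.
    by apply/seteqP; split=> y /=; rewrite hk'.
  rewrite -Tp; last exact: measurable_lt_fibres.
  by congr (mu _); apply/seteqP; split=> x /=; rewrite hk.
(* Almost everywhere, each inequality compares [f' (g (f x))], respectively [f x], with the common
   threshold from [dE], and these two values lie on the same side of it. *)
have : \forall x \ae mu, forall n, (k (g (f x)) < n)%N <-> (k (T x) < n)%N.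
  apply: ae_foralln => n.
  have := f'gf _ (measurable_itv `]-oo, dfun nu h' (n.*2%:R - 1)]).
  apply: filterS3 (ae_preimage mgf gfp (ae_dfun_le mh' h0' hfin' hatom' (n.*2%:R - 1)))
    (ae_dfun_le mh h0 hfin hatom (n.*2%:R - 1)) => x.
  rewrite hk hk' dE /= !in_itv /= => h1 h2 h3.
  by split=> [/h1/h3/h2|/h2/h3/h1].
apply: filterS2 Sgf => x /(_ I) /= -> kn.
apply/eqP; rewrite eqn_leq; apply/andP; split.
  by have /kn := ltnSn (k (T x)); rewrite ltnS.
by have /kn := ltnSn (k (g (f x))); rewrite ltnS.
Qed.

End approximation.

(** * Countable partitions into sets of finite measure *)

Section finite_fibres.
Context d (Y : measurableType d) (R : realType) (nu : {measure set Y -> \bar R}).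

Definition finite_fibres (k : Y -> nat) : Prop :=
  (forall n, measurable (k @^-1` [set n])) /\
  (forall n, (nu (k @^-1` [set n]) < +oo)%E).

Lemma exists_finite_fibres : sigma_finite setT nu -> exists k, finite_fibres k.
Proof.
move=> [F FT FP]; pose k y := xget 0%N [set n | seqDU F n y].
have mF n : measurable (seqDU F n).
  by apply: seqDU_measurable => i; have [] := FP i.
have kE n : k @^-1` [set n] = seqDU F n.
  have /trivIsetP tF := trivIset_seqDU F.
  have uniq i j y : seqDU F i y -> seqDU F j y -> i = j.
    move=> Fi Fj; apply/eqP/negPn/negP => ij.
    by have : (seqDU F i `&` seqDU F j) y by []; rewrite tF.
  apply/seteqP; split=> y; rewrite /preimage /k /=.
    case: xgetP => [m _ Fm <- //|nF _].
    have : setT y by []; rewrite FT seqDU_bigcup_eq => -[i _ Fi].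
    by case: (nF i).
  by move=> Fn; apply: xget_unique => // m /uniq; apply.
exists k; split=> n; rewrite kE //.
have [mFn fFn] := FP n; apply: le_lt_trans fFn.
by apply: le_measure; rewrite ?inE//; exact: subset_seqDU.
Qed.

(** The common refinement of two partitions, which makes the sets [B k] of the density proof a
    filter base. *)
Lemma finite_fibres_pair (k l : Y -> nat) : finite_fibres k -> finite_fibres l ->
  finite_fibres (fun y => pickle (k y, l y)).
Proof.
move=> [mk fk] [ml _].
have E n : (fun y => pickle (k y, l y)) @^-1` [set n] =
    if @pickle_inv (nat * nat)%type n is Some ij then
      k @^-1` [set ij.1] `&` l @^-1` [set ij.2] else set0.
  apply/seteqP; split=> y /=.
    by move=> <-; rewrite pickleK_inv.
  case E : pickle_inv => [[i j]|//] /= [ki lj].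
  have := @pickle_invK (nat * nat)%type n; rewrite /ocancel E /= => <-.
  by rewrite ki lj.
split=> n; rewrite E; case: pickle_inv => [[i j]|] //=.
- exact: measurableI.
- apply: le_lt_trans (fk i); apply: le_measure; rewrite ?inE//.
  exact: measurableI.
- by rewrite measure0.
Qed.

(** The parity of the refined label records membership in [E]. *)
Lemma finite_fibres_indic (k : Y -> nat) (E : set Y) : finite_fibres k -> measurable E ->
  finite_fibres (fun y => (k y).*2 + (y \in E))%N.
Proof.
move=> [mk fk] mE.
have kE n : (fun y => (k y).*2 + (y \in E))%N @^-1` [set n] =
    k @^-1` [set n./2] `&` (if odd n then E else ~` E).
  apply/seteqP; split=> y /=.
    move=> <-; split; first by case: (y \in E); lia.
    by rewrite oddD odd_double /=; case: ifPn; rewrite oddb ?inE// notin_setE.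
  move=> [-> +]; case: ifPn => [on Ey|en nEy].
    by rewrite mem_set//; lia.
  by rewrite memNset//; lia.
split=> n; rewrite kE.
  by apply: measurableI => //; case: ifP => // _; exact: measurableC.
apply: le_lt_trans (fk n./2); apply: le_measure; rewrite ?inE//.
by apply: measurableI => //; case: ifP => // _; exact: measurableC.
Qed.

End finite_fibres.

(** * Density of the isomorphisms *)

Lemma dense_isomorphism (R : realType) (X Y : ptopologicalType)
    (MX : dense_metric R X) (MY : dense_metric R Y)
    (mu : {measure set (borel X) -> \bar R}) (nu : {measure set (borel Y) -> \bar R}) :
  (forall x, mu [set x] = 0%E) -> (forall y, nu [set y] = 0%E) ->
  sigma_finite setT nu -> dense (msmap_isomorphism mu nu).
Proof.
move=> muP nuP sfnu O [T OT] oO.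
pose B (k : Y -> nat) : set (msmap_space mu nu) :=
  [set S | msmap_isomorphism mu nu S /\
    \forall x \ae mu, k (val (S : msmap mu nu) x) = k (val (T : msmap mu nu) x)].
have [k0 fk0] := exists_finite_fibres sfnu.
pose F := filter_from (finite_fibres nu) B.
have FF : Filter F.
  apply: filter_from_filter; first by exists k0.
  move=> k l fk fl; exists (fun y => pickle (k y, l y)); first exact: finite_fibres_pair.
  move=> S [iS kl]; split; split=> //; apply: filterS kl => x /(pcan_inj pickleK);
    by case.
have FT : F --> (T : msmap_space mu nu).
  apply/cvg_msmap_spaceP => E; have [mE _] := set_valP E.
  apply/cvgrPdist_lt => e e0.
  (* If [S] and [T] give this label the same value almost everywhere, the parities show that their
     preimages of [E] differ by a null set, so the distance is 0 whatever [e] is. *)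
  exists (fun y => (k0 y).*2 + (y \in val E))%N; first exact: finite_fibres_indic.
  move=> S [_ ST] /=; rewrite (_ : mu _ = 0%E) ?subrr ?normr0//.
  apply/ae_iff_setY.
  - by apply: measurable_preimage => //; exact: measurable_msmap.
  - by apply: measurable_preimage => //; exact: measurable_msmap.
  apply: filterS ST => x /(congr1 odd); rewrite !oddD !odd_double /= !oddb.
  move=> h; split=> /mem_set; first by rewrite h => /set_mem.
  by rewrite -h => /set_mem.
have [k [mk fk] kO] : F O by apply: FT; exact: open_nbhs_nbhs.
have [S iS ST] := exists_isomorphism MX MY muP nuP (measurable_msmap (T : msmap mu nu))
  (msmap_measure_preserving (T : msmap mu nu)) mk fk.
by exists S; split=> //; apply: kO.
Qed.

Theorem theorem3p12 (R : realType) (X Y : ptopologicalType)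
    (mu : {sigma_finite_measure set (borel X) -> \bar R})
    (nu : {sigma_finite_measure set (borel Y) -> \bar R}) :
  polish R X -> polish R Y ->
  (0 < mu setT)%E -> (0 < nu setT)%E ->
  nonatomic mu -> nonatomic nu ->
  residual (msmap_isomorphism mu nu).
Proof.
move=> /polish_dense_metric[MX] /polish_dense_metric[MY] _ _ namu nanu.
exists (msmap_isomorphism mu nu); split => //.
  by apply: (Gdelta_isomorphism MX MY); exact: sigma_finiteT.
apply: (dense_isomorphism MX MY); last exact: sigma_finiteT.
- by move=> x; exact: (nonatomic_point MX).
- by move=> y; exact: (nonatomic_point MY).
Qed.
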